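(* Let $J\subset\mathbb R$ be an interval, let $A$ be a continuous real $n\times n$ matrix function on $J$ that is diagonalizable by a constant similarity matrix, let $f\colon J\to\mathbb R^n$ be continuous, and let $B(t)=A(t)^{T}$. Let $\nu=\overset{*}{\nu}+\widetilde\nu\, i$ ($\overset{*}{\nu}=\mathrm{Re}\,\nu$, $\widetilde\nu=\mathrm{Im}\,\nu\neq0$) be a complex (constant) eigenvector of $B(t)$, $t\in J$, corresponding to the eigenfunction $\lambda(t)=\overset{*}{\lambda}(t)+\widetilde\lambda(t)\, i$ ($\overset{*}{\lambda}(t)=\mathrm{Re}\,\lambda(t)$, $\widetilde\lambda(t)=\mathrm{Im}\,\lambda(t)$), i.e. $B(t)\nu=\lambda(t)\nu$ for all $t\in J$. Fix $t_0\in J$ and define for $(t,x)\in J\times\mathbb R^n$ $$\gamma_1(t,x)=\Bigl(\overset{*}{\nu}x\cos\int_{t_0}^{t}\widetilde\lambda(\zeta)\,d\zeta+\widetilde\nu x\sin\int_{t_0}^{t}\widetilde\lambda(\zeta)\,d\zeta\Bigr)\exp\Bigl(-\int_{t_0}^{t}\overset{*}{\lambda}(\zeta)\,d\zeta\Bigr),$$ $$\gamma_2(t,x)=\Bigl(\widetilde\nu x\cos\int_{t_0}^{t}\widetilde\lambda(\zeta)\,d\zeta-\overset{*}{\nu}x\sin\int_{t_0}^{t}\widetilde\lambda(\zeta)\,d\zeta\Bigr)\exp\Bigl(-\int_{t_0}^{t}\overset{*}{\lambda}(\zeta)\,d\zeta\Bigr).$$ Then the system $\dfrac{dx}{dt}=A(t)x+f(t)$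 has the first integrals $$F_\tau\colon(t,x)\mapsto\gamma_\tau(t,x)-\int_{t_0}^{t}\gamma_\tau(\zeta,f(\zeta))\,d\zeta\quad\text{for all }(t,x)\in J\times\mathbb R^n,\quad\tau=1,2.$$
   Context: For a vector $\nu=(\nu_1,\dots,\nu_n)$ and $x\in\mathbb R^n$, $\nu x=\sum_{\xi=1}^n\nu_\xi x_\xi$; eigenvectors are regarded as columns in $B(t)\nu=\lambda(t)\nu$. ''$A$ is diagonalizable by a constant similarity matrix'' means that there is a constant nonsingular (possibly complex) matrix $S$ such that $S^{-1}A(t)S$ is diagonal for all $t\in J$ (such systems are called algebraic reducible). A first integral of $dx/dt=X(t,x)$ on a domain $G'$ is a continuously differentiable function $F\colon G'\to\mathbb R$ with $\partial_tF(t,x)+\sum_{\xi=1}^nX_\xi(t,x)\,\partial_{x_\xi}F(t,x)=0$ for all $(t,x)\in G'$. *)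

(* Defs.v *)
From HB Require Import structures.
From mathcomp Require Import all_boot all_order all_algebra.
From mathcomp Require Import all_classical all_reals all_analysis.
From mathcomp Require Import complex.

Set Implicit Arguments.
Unset Strict Implicit.
Unset Printing Implicit Defensive.

Import Order.TTheory GRing.Theory Num.Theory.
Import numFieldNormedType.Exports.

Local Open Scope classical_set_scope.
Local Open Scope ring_scope.
Local Open Scope complex_scope.

(* The sign convention for b < a is needed because t may lie on either side
   of the base point t0. *)
Definition oriented_integral (R : realType) (a b : R) (g : R -> R) : R :=
  if a <= b then \int[@lebesgue_measure R]_(z in `[a, b]) g z
  else - \int[@lebesgue_measure R]_(z in `[b, a]) g z.

(* The derivative of g at a relative to D is l: the usual derivative if a is
   interior to D, a one-sided one if a is an endpoint of an interval D. *)
Definition has_derivative_within (R : realType) (D : set R) (g : R -> R)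
    (a l : R) : Prop :=
  (g s - g a) / (s - a) @[s --> within D a^'] --> l.

Definition has_partial_t (R : realType) (n : nat) (G : set (R * 'cV[R]_n))
    (F : R * 'cV[R]_n -> R) (t : R) (x : 'cV[R]_n) (l : R) : Prop :=
  has_derivative_within [set s | G (s, x)] (fun s => F (s, x)) t l.

Definition has_partial_x (R : realType) (n : nat) (G : set (R * 'cV[R]_n))
    (F : R * 'cV[R]_n -> R) (xi : 'I_n) (t : R) (x : 'cV[R]_n) (l : R) : Prop :=
  let shift (h : R) := x + h *: delta_mx xi 0 in
  has_derivative_within [set h | G (t, shift h)] (fun h => F (t, shift h)) 0 l.

(* F is continuously differentiable on G, with partial derivatives Ft and
   Fx xi; G is meant to be open or an interval times the whole space. *)
Definition C1_on (R : realType) (n : nat) (G : set (R * 'cV[R]_n))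
    (F Ft : R * 'cV[R]_n -> R) (Fx : 'I_n -> R * 'cV[R]_n -> R) : Prop :=
  [/\ forall t x, G (t, x) -> has_partial_t G F t x (Ft (t, x)),
      forall xi t x, G (t, x) -> has_partial_x G F xi t x (Fx xi (t, x)),
      {within G, continuous Ft} &
      forall xi, {within G, continuous (Fx xi)}].

Definition first_integral (R : realType) (n : nat) (G : set (R * 'cV[R]_n))
    (X : R -> 'cV[R]_n -> 'cV[R]_n) (F : R * 'cV[R]_n -> R) : Prop :=
  exists (Ft : R * 'cV[R]_n -> R) (Fx : 'I_n -> R * 'cV[R]_n -> R),
    C1_on G F Ft Fx /\
    forall t x, G (t, x) ->
      Ft (t, x) + \sum_(xi < n) X t x xi 0 * Fx xi (t, x) = 0.

Definition complexify (R : realType) (m n : nat) (M : 'M[R]_(m, n)) :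
  'M[R[i]]_(m, n) := map_mx (real_complex R) M.

Definition constant_diagonalizable (R : realType) (n : nat) (J : set R)
    (A : R -> 'M[R]_n) : Prop :=
  exists2 S : 'M[R[i]]_n, S \in unitmx &
    forall t, J t -> is_diag_mx (invmx S *m complexify (A t) *m S).

Definition re_vec (R : realType) (n : nat) (nu : 'cV[R[i]]_n) : 'cV[R]_n :=
  map_mx (@complex.Re R) nu.

Definition im_vec (R : realType) (n : nat) (nu : 'cV[R[i]]_n) : 'cV[R]_n :=
  map_mx (@complex.Im R) nu.

Definition pairing (R : realType) (n : nat) (u x : 'cV[R]_n) : R :=
  \sum_(xi < n) u xi 0 * x xi 0.

Definition gamma1 (R : realType) (n : nat) (t0 : R) (lambda : R -> R[i])
    (nu : 'cV[R[i]]_n) (t : R) (x : 'cV[R]_n) : R :=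
  let phase := oriented_integral t0 t (fun z => complex.Im (lambda z)) in
  (pairing (re_vec nu) x * cos phase + pairing (im_vec nu) x * sin phase)
  * expR (- oriented_integral t0 t (fun z => complex.Re (lambda z))).

Definition gamma2 (R : realType) (n : nat) (t0 : R) (lambda : R -> R[i])
    (nu : 'cV[R[i]]_n) (t : R) (x : 'cV[R]_n) : R :=
  let phase := oriented_integral t0 t (fun z => complex.Im (lambda z)) in
  (pairing (im_vec nu) x * cos phase - pairing (re_vec nu) x * sin phase)
  * expR (- oriented_integral t0 t (fun z => complex.Re (lambda z))).

(* Main.v *)
(** If [u] solves the adjoint system [u' = - A^T u], then along a solution of
    [x' = A x + f] the scalar product [u x] has derivative [u f], so that
    [u x - \int u f] is a first integral.  With [phi] and [L] the integrals of
    [Im lambda] and [Re lambda], the vector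
    [u = e^{-L} (cos phi Re nu + sin phi Im nu)], the real part of
    [e^{- \int lambda} nu], is such a solution, and [gamma1 = u x].  Replacing [nu]
    by the eigenvector [- i nu], that is [(Re nu, Im nu)] by [(Im nu, - Re nu)],
    turns [gamma1] into [gamma2]. *)
Require Import Defs.
From mathcomp Require Import all_boot all_order all_algebra.
From mathcomp Require Import all_classical all_reals all_analysis.
From mathcomp Require Import complex.
From mathcomp Require Import ring lra.
Import Order.TTheory GRing.Theory Num.Theory.
Import numFieldNormedType.Exports.
Local Open Scope classical_set_scope.
Local Open Scope ring_scope.
Local Open Scope complex_scope.

Set Implicit Arguments.
Unset Strict Implicit.
Unset Printing Implicit Defensive.

(** * Calculus of derivatives relative to a set *)

Section DerivativeWithin.
Context {R : realType} (D : set R).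
Implicit Types (g h : R -> R) (a l m c : R).

(** The increment of [g] is the difference quotient times [s - a], a product with limit [l * 0]. The
    decomposition [gE] also holds at [s = a], where the factor [s - a] vanishes. *)
Lemma has_derivative_within_cvg_dnbhs g a l :
  has_derivative_within D g a l -> g s @[s --> within D a^'] --> g a.
Proof.
move=> gl.
have gE : g = fun s => (g s - g a) / (s - a) * (s - a) + g a.
  apply/funext => s; have [->|sa] := eqVneq s a.
    by rewrite !subrr mulr0 add0r.
  by rewrite divfK ?subr_eq0// subrK.
rewrite {1}gE.
rewrite [X in _ --> X](_ : _ = l * (a - a) + g a); last by ring.
apply: cvgD; last exact: cvg_cst.
apply: cvgM; first exact: gl.
apply: cvgB; last exact: cvg_cst.
exact: cvg_trans (cvg_within _) (cvg_within _).
Qed.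

(** The punctured limit extends over [a] itself, since [g a] lies in each of its own
    neighbourhoods. *)
Lemma has_derivative_within_continuous g a l :
  has_derivative_within D g a l -> g s @[s --> within D (nbhs a)] --> g a.
Proof.
move=> /has_derivative_within_cvg_dnbhs gl V Va.
have H : \forall s \near a, s != a -> D s -> V (g s) := gl V Va.
apply: (@filterS R (nbhs a) _ _ _ _ H) => s {}H Ds.
have [->|sa] := eqVneq s a; last exact: H.
exact: (nbhs_singleton Va).
Qed.

Lemma has_derivative_within_cst c a : has_derivative_within D (fun=> c) a 0.
Proof.
rewrite /has_derivative_within; under eq_fun do rewrite subrr mul0r.
exact: cvg_cst.
Qed.

Lemma has_derivative_within_id a : has_derivative_within D id a 1.
Proof.
apply: (@cvg_trans _ ((fun=> 1 : R) @ within D a^')); last exact: cvg_cst.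
(* The quotient is 1 only off [a]: at [s = a] it is [0 / 0 = 0]. Hence equality is claimed on the
   punctured neighbourhood only. *)
apply: near_eq_cvg; apply: cvg_within.
have : \forall s \near a, s != a -> 1 = (s - a) / (s - a); last by [].
by apply: (@nearW _ (nbhs a)) => s sa; rewrite divff// subr_eq0.
Qed.

Lemma has_derivative_withinD g h a l m :
  has_derivative_within D g a l -> has_derivative_within D h a m ->
  has_derivative_within D (fun s => g s + h s) a (l + m).
Proof.
move=> gl hm; rewrite /has_derivative_within.
under eq_fun do rewrite opprD addrACA mulrDl.
exact: cvgD.
Qed.

Lemma has_derivative_withinM g h a l m :
  has_derivative_within D g a l -> has_derivative_within D h a m ->
  has_derivative_within D (fun s => g s * h s) a (l * h a + g a * m).
Proof.
move=> gl hm; rewrite /has_derivative_within.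
have E s : (g s * h s - g a * h a) / (s - a) =
    (g s - g a) / (s - a) * h s + g a * ((h s - h a) / (s - a)) by ring.
under eq_fun do rewrite E.
apply: cvgD; first by apply: cvgM => //; exact: has_derivative_within_cvg_dnbhs hm.
by apply: cvgM => //; exact: cvg_cst.
Qed.

Lemma has_derivative_withinN g a l :
  has_derivative_within D g a l ->
  has_derivative_within D (fun s => - g s) a (- l).
Proof.
move=> gl; rewrite /has_derivative_within.
under eq_fun do rewrite -opprD mulNr.
exact: cvgN.
Qed.

Lemma has_derivative_within_sum (I : Type) (r : seq I) (g : I -> R -> R) a
    (l : I -> R) :
  (forall i, has_derivative_within D (g i) a (l i)) ->
  has_derivative_within D (fun s => \sum_(i <- r) g i s) a (\sum_(i <- r) l i).
Proof.
move=> gl; elim: r => [|i r IHr].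
  under eq_fun do rewrite big_nil.
  by rewrite big_nil; exact: has_derivative_within_cst.
under eq_fun do rewrite big_cons.
by rewrite big_cons; exact: has_derivative_withinD.
Qed.

(** Carathéodory's form [h y - h (g a) = k y * (y - g a)], with [k] continuous at [g a] and
    [k (g a) = m], avoids dividing by [g s - g a], which may vanish. *)
Lemma has_derivative_within_comp g h a l m :
  has_derivative_within D g a l -> is_derive (g a) 1 h m ->
  has_derivative_within D (fun s => h (g s)) a (m * l).
Proof.
move=> gl /is_derive1_caratheodory[k [hk ck <-]].
rewrite /has_derivative_within; under eq_fun do rewrite hk -mulrA.
apply: cvgM => //; apply: (@cvg_comp _ _ _ g k _ (nbhs (g a))) => //.
exact: has_derivative_within_cvg_dnbhs gl.
Qed.

End DerivativeWithin.

(** * Oriented integrals and the fundamental theorem of calculus on an interval *)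

Section OrientedIntegral.
Context {R : realType} (J : interval R) (g : R -> R).
Hypothesis g_cont : {within [set` J], continuous g}.
Implicit Types a b c t s : R.

Lemma subset_itv_segment a b : a \in J -> b \in J -> `[a, b] `<=` [set` J].
Proof.
move=> aJ bJ z /=; rewrite in_itv /= => zab.
exact: (@interval_is_interval _ J a b).
Qed.

Lemma integrable_segment a b : a \in J -> b \in J ->
  (@lebesgue_measure R).-integrable `[a, b] (EFin \o g).
Proof.
move=> aJ bJ; apply: continuous_compact_integrable; first exact: segment_compact.
exact: continuous_subspaceW (subset_itv_segment aJ bJ) g_cont.
Qed.

Lemma oriented_integral_ge a b : a <= b ->
  oriented_integral a b g = \int[@lebesgue_measure R]_(z in `[a, b]) g z.
Proof. by rewrite /oriented_integral => ->. Qed.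

(** Swapping the bounds swaps the two branches of the definition, except at [a = b], where both
    sides are integrals over one point and vanish. *)
Lemma oriented_integralC a b :
  oriented_integral b a g = - oriented_integral a b g.
Proof.
rewrite /oriented_integral; case: ltgtP => [||->]; rewrite ?opprK//.
by rewrite set_itv1 Rintegral_set1 oppr0.
Qed.

(** The ordered case [le3] is additivity of the integral; every other order of the three points
    follows from it by reversing orientations. *)
Lemma oriented_integral_chasles a b c : a \in J -> b \in J -> c \in J ->
  oriented_integral a c g = oriented_integral a b g + oriented_integral b c g.
Proof.
have le3 x y z : x \in J -> z \in J -> x <= y -> y <= z ->
    oriented_integral x z g = oriented_integral x y g + oriented_integral y z g.
  move=> xJ zJ xy yz; rewrite !oriented_integral_ge//; last exact: le_trans yz.
  have xz := integrable_segment xJ zJ.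
  (* Removing the common endpoint [y], a null set, from the second segment makes the two pieces
     disjoint. *)
  rewrite -[X in _ + X]Rintegral_itv_obnd_cbnd; last first.
    apply: integrableS xz => //; apply: subset_itvr; by rewrite bnd_simp.
  by rewrite -(@Rintegral_itvB _ _ (BLeft x))// addrC subrK.
move=> aJ bJ cJ.
have [ab|/ltW ab] := leP a b; have [bc|/ltW bc] := leP b c;
  have [ac|/ltW ac] := leP a c.
- exact: le3.
- by have := le3 _ _ _ bJ aJ bc ac;
  rewrite (oriented_integralC a b) (oriented_integralC a c); lra.
- by have := le3 _ _ _ aJ bJ ac bc;
  rewrite (oriented_integralC b c); lra.
- by have := le3 _ _ _ cJ bJ ac ab;
  rewrite (oriented_integralC b c) (oriented_integralC a c); lra.
- by have := le3 _ _ _ bJ cJ ab ac;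
  rewrite (oriented_integralC a b); lra.
- by have := le3 _ _ _ bJ aJ bc ac;
  rewrite (oriented_integralC a b) (oriented_integralC a c); lra.
- by have := le3 _ _ _ bJ cJ ab ac;
  rewrite (oriented_integralC a b); lra.
- by have := le3 _ _ _ cJ aJ bc ab;
  rewrite (oriented_integralC a b) (oriented_integralC a c) (oriented_integralC b c);
  lra.
Qed.

(** Integrating [v - e <= g <= v + e] over the segment gives the bound. The condition on [z] is
    symmetric about [a], so that it serves both orientations. *)
Lemma oriented_integral_dist (a b v e : R) : a \in J -> b \in J ->
  (forall z, z \in J -> `|z - a| <= `|b - a| -> `|v - g z| <= e) ->
  `|v * (b - a) - oriented_integral a b g| <= e * `|b - a|.
Proof.
have le_case x y : x \in J -> y \in J -> x <= y ->
    (forall z, x <= z <= y -> `|v - g z| <= e) ->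
    `|v * (y - x) - oriented_integral x y g| <= e * (y - x).
  move=> xJ yJ xy gv; rewrite oriented_integral_ge//; set I := Rintegral _ _ _.
  have xyg := integrable_segment xJ yJ.
  have int_cst (c : R) : (@lebesgue_measure R).-integrable `[x, y] (EFin \o cst c).
    apply: continuous_compact_integrable; first exact: segment_compact.
    by apply: continuous_subspaceT => ?; exact: cvg_cst.
  have int_cstE (c : R) : \int[@lebesgue_measure R]_(z in `[x, y]) cst c z =
      c * (y - x).
    rewrite Rintegral_cst//= lebesgue_measure_itv/= lte_fin.
    (* The length formula distinguishes [x < y] from the degenerate segment, whose measure is 0. *)
    by case: ltgtP xy => // ->; rewrite subrr.
  have lo : \int[@lebesgue_measure R]_(z in `[x, y]) cst (v - e) z <= I.
    apply: le_Rintegral => // z /=; rewrite in_itv/= => /gv.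
    by rewrite ler_distlC; lra.
  have hi : I <=
      \int[@lebesgue_measure R]_(z in `[x, y]) cst (v + e) z.
    apply: le_Rintegral => // z /=; rewrite in_itv/= => /gv.
    by rewrite ler_distlC; lra.
  move: lo hi; rewrite !int_cstE ler_distl.
  move: I => I; clear; lra.
move=> aJ bJ gv; have [ab|/ltW ba] := leP a b.
  rewrite [X in _ <= _ * X]ger0_norm ?subr_ge0//; apply: le_case => // z azb.
  apply: gv; first by apply: subset_itv_segment azb.
  by rewrite !ger0_norm; lra.
(* For [b <= a], exchanging [a] and [b] changes the sign of both [v * (b - a)] and the integral, so
   the absolute value is the same. *)
rewrite [X in _ <= _ * X]distrC [X in _ <= _ * X]ger0_norm ?subr_ge0//.
rewrite (oriented_integralC b a) opprK -normrN opprD -mulrN opprB.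
apply: le_case => // z bza.
apply: gv; first by apply: subset_itv_segment bza.
by rewrite !ler0_norm; lra.
Qed.

(** The increment from [t] to [s] is the integral of [g] between them, which differs from
    [g t * (s - t)] by at most [e * |s - t|] once [g] is within [e] of [g t]. Only points of [J]
    enter, so endpoints of [J] are covered. *)
Lemma has_derivative_within_oriented_integral t0 t : t0 \in J -> t \in J ->
  has_derivative_within [set` J] (fun s => oriented_integral t0 s g) t (g t).
Proof.
move=> t0J tJ; apply/cvgrPdist_le => e e0.
have /subspace_continuousP/(_ t tJ)/cvgrPdist_le/(_ e e0) := g_cont.
move=> /nbhs_ballP[d d0 gd].
have : \forall s \near t, s != t -> s \in J ->
    `|g t - (oriented_integral t0 s g - oriented_integral t0 t g) / (s - t)| <= e.
  apply: (@filterS _ _ _ _ _ _ (nbhsx_ballx t d d0)) => s ts st sJ.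
  have st0 : 0 < `|s - t| by rewrite normr_gt0 subr_eq0.
  (* Multiplying by [|s - t|] clears the denominator and gives the form of [oriented_integral_dist]
     with [v = g t]. *)
  rewrite -(ler_pM2r st0) -normrM mulrBl divfK ?subr_eq0//.
  rewrite (@oriented_integral_chasles t0 t s)// addrAC subrr add0r.
  apply: oriented_integral_dist => // z zJ zt; apply: gd => //.
  by rewrite /ball/= distrC (le_lt_trans zt)// distrC.
by [].
Qed.

End OrientedIntegral.

(** * Continuity relative to a set, for coordinates, sums, products and projections *)

Section WithinContinuity.
Context {R : realType}.

Lemma within_coord_continuous m n (D : set R) (M : R -> 'M[R]_(m, n)) i j :
  {within D, continuous M} -> {within D, continuous (fun s => M s i j)}.
Proof.
move=> /subspace_continuousP cM; apply/subspace_continuousP => t Dt.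
apply: (@cvg_comp _ _ _ M (fun N : 'M[R]_(m, n) => N i j) _ (nbhs (M t))).
  exact: cM.
exact: coord_continuous.
Qed.

Lemma within_sum_continuous (T : topologicalType) (D : set T) n
    (h : 'I_n -> T -> R) :
  (forall i, {within D, continuous (h i)}) ->
  {within D, continuous (fun s => \sum_(i < n) h i s)}.
Proof.
move=> ch; apply/subspace_continuousP => t Dt.
apply: cvg_big => [|i _]; first exact: add_continuous.
by have /subspace_continuousP := ch i; apply.
Qed.

Lemma within_mul_continuous (T : topologicalType) (D : set T) (g h : T -> R) :
  {within D, continuous g} -> {within D, continuous h} ->
  {within D, continuous (fun s => g s * h s)}.
Proof.
move=> /subspace_continuousP cg /subspace_continuousP ch.
apply/subspace_continuousP => t Dt.
by apply: cvgM; [exact: cg | exact: ch].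
Qed.

Lemma within_add_continuous (T : topologicalType) (D : set T) (g h : T -> R) :
  {within D, continuous g} -> {within D, continuous h} ->
  {within D, continuous (fun s => g s + h s)}.
Proof.
move=> /subspace_continuousP cg /subspace_continuousP ch.
apply/subspace_continuousP => t Dt.
by apply: cvgD; [exact: cg | exact: ch].
Qed.

Lemma within_opp_continuous (T : topologicalType) (D : set T) (g : T -> R) :
  {within D, continuous g} -> {within D, continuous (fun s => - g s)}.
Proof.
move=> /subspace_continuousP cg; apply/subspace_continuousP => t Dt.
by apply: cvgN; exact: cg.
Qed.

Lemma within_fst_continuous (T : topologicalType) (D : set R) (h : R -> R) :
  {within D, continuous h} ->
  {within D `*` [set: T], continuous (fun p : R * T => h p.1)}.
Proof.
move=> /subspace_continuousP ch; apply/subspace_continuousP => -[t x] [/= Dt _].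
apply: (@cvg_comp _ _ _ fst h _ (within D (nbhs t))); last exact: ch.
move=> V tV.
have : \forall q \near (t, x), D q.1 -> V q.1
  by exact: (@cvg_fst _ _ (nbhs t) (nbhs x) _ (fun s => D s -> V s)).
by apply: (@filterS _ (nbhs (t, x))) => q DV [/DV].
Qed.

Lemma within_snd_coord_continuous n (D : set R) (i : 'I_n) :
  {within D `*` [set: 'cV[R]_n],
    continuous (fun p : R * 'cV[R]_n => p.2 i 0)}.
Proof.
apply: continuous_subspaceT => -[t x].
apply: (@cvg_comp _ _ _ snd (fun N : 'cV[R]_n => N i 0) _ (nbhs x)).
  exact: cvg_snd.
exact: coord_continuous.
Qed.

End WithinContinuity.

(** * First integrals from solutions of the adjoint system *)

Section AdjointSolution.
Context {R : realType} (n : nat) (J : interval R).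
Variables (A : R -> 'M[R]_n) (f u : R -> 'cV[R]_n) (t0 : R).
Hypothesis A_cont : {within [set` J], continuous A}.
Hypothesis f_cont : {within [set` J], continuous f}.
Hypothesis t0_in_J : t0 \in J.
Hypothesis u_adjoint : forall t, t \in J -> forall i,
  has_derivative_within [set` J] (fun s => u s i 0) t
    (- ((A t)^T *m u t) i 0).

Lemma adjoint_solution_continuous i :
  {within [set` J], continuous (fun s => u s i 0)}.
Proof.
apply/subspace_continuousP => t tJ.
exact: has_derivative_within_continuous (@u_adjoint t tJ i).
Qed.

Lemma first_integral_of_adjoint :
  first_integral ([set` J] `*` [set: 'cV[R]_n])
    (fun t x => A t *m x + f t)
    (fun p => pairing (u p.1) p.2 -
              oriented_integral t0 p.1 (fun z => pairing (u z) (f z))).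
Proof.
(* The time derivative comes from [u' = - A^T u] and the fundamental theorem; the gradient in [x] is
   [u]. *)
exists (fun p => - pairing ((A p.1)^T *m u p.1) p.2 - pairing (u p.1) (f p.1)).
exists (fun i p => u p.1 i 0).
have uf_cont : {within [set` J], continuous (fun z => pairing (u z) (f z))}.
  apply: within_sum_continuous => i; apply: within_mul_continuous.
    exact: adjoint_solution_continuous.
  exact: within_coord_continuous.
split; last first.
  move=> t x _ /=; rewrite /pairing.
  under [X in _ + X]eq_bigr do rewrite mxE mulrDl.
  rewrite big_split/= [X in _ + (_ + X)](_ : _ =
      \sum_i u t i 0 * f t i 0); last first.
    by apply: eq_bigr => i _; rewrite mulrC.
  rewrite [X in _ + (X + _)](_ : _ = \sum_i ((A t)^T *m u t) i 0 * x i 0).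
    by ring.
  under eq_bigr do rewrite mxE mulr_suml.
  (* Exchanging the sums is the duality between [A] and its transpose: the pairing of [u] with [A x]
     is that of [A^T u] with [x]. *)
  rewrite exchange_big/=; apply: eq_bigr => i _.
  rewrite mxE mulr_suml; apply: eq_bigr => j _.
  by rewrite mxE; ring.
split.
- move=> t x [tJ _]; rewrite /has_partial_t /=.
  rewrite (_ : [set s | _] = [set` J]); last first.
    by apply/seteqP; split => s //= [].
  apply: has_derivative_withinD; last first.
    by apply: has_derivative_withinN; exact: has_derivative_within_oriented_integral.
  rewrite -sumrN; apply: has_derivative_within_sum => i.
  rewrite -mulNr -[X in has_derivative_within _ _ _ X]addr0.
  rewrite -[X in _ + X](mulr0 (u t i 0)).
  apply: has_derivative_withinM; first exact: u_adjoint.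
  exact: has_derivative_within_cst.
- move=> i t x _; rewrite /has_partial_x /=.
  rewrite -[X in has_derivative_within _ _ _ X]addr0.
  apply: has_derivative_withinD; last exact: has_derivative_within_cst.
  (* The value [u t i 0] is rewritten in the shape produced by the sum and product rules; only the
     term [j = i] is nonzero. *)
  rewrite [X in has_derivative_within _ _ _ X](_ : _ =
     \sum_(j < n) (0 * (x + 0 *: delta_mx i 0 : 'cV[R]_n) j 0 +
        u t j 0 * (0 + (1 * (delta_mx i 0 : 'cV[R]_n) j 0 + 0 * 0)))); last first.
    rewrite (bigD1 i)//= big1 => [|j ji]; rewrite !mxE ?eqxx ?(negPf ji)/=; ring.
  apply: has_derivative_within_sum => j.
  apply: has_derivative_withinM; first exact: has_derivative_within_cst.
  rewrite [X in has_derivative_within _ X](_ : _ =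
      fun s => x j 0 + s * (delta_mx i 0 : 'cV[R]_n) j 0); last first.
    by apply/funext => s; rewrite !mxE.
  apply: has_derivative_withinD; first exact: has_derivative_within_cst.
  apply: has_derivative_withinM; first exact: has_derivative_within_id.
  exact: has_derivative_within_cst.
- apply: within_add_continuous; apply: within_opp_continuous; last first.
    exact: within_fst_continuous uf_cont.
  apply: within_sum_continuous => i; apply: within_mul_continuous; last first.
    exact: within_snd_coord_continuous.
  apply: (@within_fst_continuous _ _ _ (fun s => ((A s)^T *m u s) i 0)).
  rewrite (_ : (fun s => _) = fun s => \sum_j A s j i * u s j 0); last first.
    by apply/funext => s; rewrite mxE; apply: eq_bigr => j _; rewrite mxE.
  apply: within_sum_continuous => j; apply: within_mul_continuous; last first.
    exact: adjoint_solution_continuous.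
  exact: within_coord_continuous.
- move=> i; apply: (@within_fst_continuous _ _ _ (fun s => u s i 0)).
  exact: adjoint_solution_continuous.
Qed.

End AdjointSolution.

(** * The adjoint solution built from an eigenvector [p + i q] with eigenvalue [a + i b], in real
    form *)

Section RotatingSolution.
Context {R : realType} (n : nat) (J : interval R).
Variables (A : R -> 'M[R]_n) (f : R -> 'cV[R]_n) (t0 : R).
Variables (a b : R -> R) (p q : 'cV[R]_n).
Hypothesis A_cont : {within [set` J], continuous A}.
Hypothesis f_cont : {within [set` J], continuous f}.
Hypothesis t0_in_J : t0 \in J.
Hypothesis pE : forall t, t \in J -> (A t)^T *m p = a t *: p - b t *: q.
Hypothesis qE : forall t, t \in J -> (A t)^T *m q = a t *: q + b t *: p.
Variable k : 'I_n.
Hypothesis pq_neq0 : p k 0 ^+ 2 + q k 0 ^+ 2 != 0.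

Let coord_continuous_trmul (v : 'cV[R]_n) :
  {within [set` J], continuous (fun s => ((A s)^T *m v) k 0)}.
Proof.
rewrite (_ : (fun s => _) = fun s => \sum_j A s j k * v j 0); last first.
  by apply/funext => s; rewrite mxE; apply: eq_bigr => j _; rewrite mxE.
apply: within_sum_continuous => j; apply: within_mul_continuous.
  exact: within_coord_continuous.
by apply: continuous_subspaceT => ?; exact: cvg_cst.
Qed.

Let lin_continuous (c d : R) (v w : 'cV[R]_n) : {within [set` J], continuous
  (fun s => c * ((A s)^T *m v) k 0 + d * ((A s)^T *m w) k 0)}.
Proof.
apply: within_add_continuous; apply: within_mul_continuous => //;
  by apply: continuous_subspaceT => ?; exact: cvg_cst.
Qed.

(** Continuity of the eigenvalue is inherited from [A]. At coordinate [k], adding [p_k] times [pE]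
    and [q_k] times [qE] cancels [b] and leaves [a * (p_k^2 + q_k^2)], so division by the nonzero
    [N] recovers [a]. *)
Lemma eigen_re_continuous : {within [set` J], continuous a}.
Proof.
pose N := p k 0 ^+ 2 + q k 0 ^+ 2.
apply: (subspace_eq_continuous _ (@lin_continuous (p k 0 / N) (q k 0 / N) p q)).
by move=> t; rewrite inE => tJ; rewrite /from_subspace/= pE// qE// !mxE /N; field.
Qed.

(** Here [p_k] times [qE] minus [q_k] times [pE] cancels [a] and leaves [b * N]. *)
Lemma eigen_im_continuous : {within [set` J], continuous b}.
Proof.
pose N := p k 0 ^+ 2 + q k 0 ^+ 2.
apply: (subspace_eq_continuous _ (@lin_continuous (p k 0 / N) (- q k 0 / N) q p)).
by move=> t; rewrite inE => tJ; rewrite /from_subspace/= pE// qE// !mxE /N; field.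
Qed.

Let phase t := oriented_integral t0 t b.
Let growth t := oriented_integral t0 t a.

(** Stated for an arbitrary pair [(p, q)] so that [gamma1] and [gamma2] are both instances. *)
Lemma first_integral_rotating :
  let gamma t x := (pairing p x * cos (phase t) + pairing q x * sin (phase t))
                   * expR (- growth t) in
  first_integral ([set` J] `*` [set: 'cV[R]_n])
    (fun t x => A t *m x + f t)
    (fun z => gamma z.1 z.2 - oriented_integral t0 z.1 (fun s => gamma s (f s))).
Proof.
move=> gamma.
pose u t := expR (- growth t) *: (cos (phase t) *: p + sin (phase t) *: q).
have -> : gamma = fun t x => pairing (u t) x.
  apply/funext => t; apply/funext => x; rewrite /gamma /pairing !mulr_suml.
  rewrite -big_split/= mulr_suml; apply: eq_bigr => i _; rewrite !mxE; ring.
apply: first_integral_of_adjoint => // t tJ i.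
have phaseD : has_derivative_within [set` J] phase t (b t).
  by apply: has_derivative_within_oriented_integral => //;
    exact: eigen_im_continuous.
have growthD : has_derivative_within [set` J] growth t (a t).
  by apply: has_derivative_within_oriented_integral => //;
    exact: eigen_re_continuous.
have cosD := has_derivative_within_comp phaseD (is_derive_cos (phase t)).
have sinD := has_derivative_within_comp phaseD (is_derive_sin (phase t)).
have expD := has_derivative_within_comp
  (has_derivative_withinN growthD) (is_derive_expR (- growth t)).
have cst (c : R) := has_derivative_within_cst [set` J] c t.
have := has_derivative_withinM expD (has_derivative_withinD
  (has_derivative_withinM cosD (cst (p i 0)))
  (has_derivative_withinM sinD (cst (q i 0)))).
rewrite [X in has_derivative_within _ X _ _ -> _](_ : _ =
    fun s => u s i 0); last first.
  by apply/funext => s; rewrite /u !mxE.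
rewrite /u -scalemxAr mulmxDr -!scalemxAr pE// qE//.
(* Differentiating the exponential gives the terms in [a], differentiating the rotation those in
   [b]; together they are coordinate [i] of [- A^T u]. *)
congr has_derivative_within; rewrite !mxE; ring.
Qed.

End RotatingSolution.

(** * Real and imaginary parts of the eigenvector equation *)

Lemma Re_sum (R : realType) (I : Type) (r : seq I) (F : I -> R[i]) :
  complex.Re (\sum_(i <- r) F i) = \sum_(i <- r) complex.Re (F i).
Proof. by apply: (big_morph (@complex.Re R)) => // -[? ?] [? ?]. Qed.

Lemma Im_sum (R : realType) (I : Type) (r : seq I) (F : I -> R[i]) :
  complex.Im (\sum_(i <- r) F i) = \sum_(i <- r) complex.Im (F i).
Proof. by apply: (big_morph (@complex.Im R)) => // -[? ?] [? ?]. Qed.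

Section ComplexEigenvector.
Context {R : realType} (n : nat) (M : 'M[R]_n) (l : R[i]) (nu : 'cV[R[i]]_n).
Hypothesis nu_eigen : complexify M *m nu = l *: nu.

(** The entries of [M] are real, so multiplication by [M] commutes with taking real parts; the minus
    sign comes from [i^2 = -1] in [l *: nu]. *)
Lemma eigenvector_re : M *m re_vec nu =
  complex.Re l *: re_vec nu - complex.Im l *: im_vec nu.
Proof.
apply/colP => i; have /(congr1 (fun v : 'cV_n => complex.Re (v i 0))) := nu_eigen.
rewrite !mxE Re_sum; case: l => c d; case: (nu i 0) => x y /= <-.
by apply: eq_bigr => j _; rewrite !mxE; case: (nu j 0) => ? ? /=; ring.
Qed.

Lemma eigenvector_im : M *m im_vec nu =
  complex.Re l *: im_vec nu + complex.Im l *: re_vec nu.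
Proof.
apply/colP => i; have /(congr1 (fun v : 'cV_n => complex.Im (v i 0))) := nu_eigen.
rewrite !mxE Im_sum; case: l => c d; case: (nu i 0) => x y /= <-.
by apply: eq_bigr => j _; rewrite !mxE; case: (nu j 0) => ? ? /=; ring.
Qed.

End ComplexEigenvector.

Theorem theorem2p2 (R : realType) (n : nat) (J : interval R)
  (A : R -> 'M[R]_n) (f : R -> 'cV[R]_n)
  (A_cont : {within [set` J], continuous A})
  (A_diag : constant_diagonalizable [set` J] A)
  (f_cont : {within [set` J], continuous f})
  (lambda : R -> R[i]) (nu : 'cV[R[i]]_n)
  (nu_complex : im_vec nu != 0)
  (nu_eigen : forall t, t \in J -> complexify (A t)^T *m nu = lambda t *: nu)
  (t0 : R) (t0_in_J : t0 \in J) :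
  let G := [set` J] `*` [set: 'cV[R]_n] in
  let X (t : R) (x : 'cV[R]_n) := A t *m x + f t in
  let F (gamma : R -> 'cV[R]_n -> R) (p : R * 'cV[R]_n) :=
    gamma p.1 p.2 - oriented_integral t0 p.1 (fun z => gamma z (f z)) in
  first_integral G X (F (gamma1 t0 lambda nu)) /\
  first_integral G X (F (gamma2 t0 lambda nu)).
Proof.
move=> G X F.
(* A coordinate where [Im nu] is nonzero makes the sum of squares positive, as needed to recover
   [lambda] from [A]. *)
have /cV0Pn[k nuk] := nu_complex.
have reE t (tJ : t \in J) := eigenvector_re (nu_eigen t tJ).
have imE t (tJ : t \in J) := eigenvector_im (nu_eigen t tJ).
have nuk_gt0 : 0 < im_vec nu k 0 ^+ 2 by rewrite exprn_even_gt0.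
split.
  apply: (@first_integral_rotating _ n J A f t0 _ _ (re_vec nu) (im_vec nu)
    _ _ _ reE imE k) => //.
  by rewrite gt_eqF// ltr_wpDl// sqr_ge0.
pose phase t := oriented_integral t0 t (fun z => complex.Im (lambda z)).
pose growth t := oriented_integral t0 t (fun z => complex.Re (lambda z)).
(* The eigenvector [- i nu] has the same eigenvalue as [nu], so phase and growth are unchanged. *)
have -> : gamma2 t0 lambda nu = fun t x => (pairing (im_vec nu) x * cos (phase t) +
    pairing (- re_vec nu) x * sin (phase t)) * expR (- growth t).
  apply/funext => t; apply/funext => x; rewrite /gamma2 -mulNr.
  congr ((_ + _ * _) * _); rewrite /pairing -sumrN.
  by apply: eq_bigr => i _; rewrite !mxE mulNr.
apply: (@first_integral_rotating _ n J A f t0 _ _ (im_vec nu) (- re_vec nu)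
  _ _ _ _ _ k) => //.
- by move=> t tJ; rewrite imE// scalerN opprK.
- by move=> t tJ; rewrite mulmxN reE// scalerN opprB addrC.
- by rewrite gt_eqF// ltr_wpDr// sqr_ge0.
Qed.
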